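(* Let $k\geq 2$ and let $G$ be a graph on $n$ vertices with $\operatorname{ppt}_k(G)=n-3$. Then $G\in \{P_5,\ P_6,\ C_5,\ C_6,\ K_{1,3},\ L(3,1),\ K_4-e,\ K_4,\ K_1\cup P_3,\ K_1\cup P_4,\ K_1\cup C_3,\ K_1\cup C_4,\ K_2\cup K_2,\ \overline{K_3},\ \overline{K_2}\cup K_2\}\cup \mathfrak{G}$, where $\mathfrak{G}$ is the family of connected graphs on $5$ vertices with maximum degree equal to $3$.
   Context: All graphs are finite and simple, and are not assumed to be connected; membership of graphs in a list is up to isomorphism. $P_n$, $C_n$, $K_n$ denote the path, cycle and complete graph on $n$ vertices; $\overline{G}$ is the complement of $G$ (so $\overline{K_m}$ is the edgeless graph on $m$ vertices); $\cup$ between graphs denotes disjoint union; $K_4-e$ is $K_4$ with one edge removed; $K_{1,3}$ is the star with three leaves; $L(3,1)$ is the graph obtained from $K_3$ by adding one new vertex adjacent to exactly one vertex of $K_3$. For a graph $G$ and $S\subseteq V(G)$, let $N(v)$ be the set of neighbors of $v$ and $N[S]=S\cup\bigcup_{s\in S}N(s)$. Define $S^{[0]}=S$, $S^{[1]}=N[S]$, and for $t\geq 1$, $S^{[t+1]}=S^{[t]}\cup\{w\in V(G) : \exists\, v\in S^{[t]},\ w\in N(v)\setminus S^{[t]} \text{ and } |N(v)\setminus S^{[t]}|\leq k\}$. The set $S$ is a $k$-power dominating set of $G$ if $S^{[\ell]}=V(G)$ for some $\ell$; a minimum $k$-power dominating set is one of minimum cardinality. For a $k$-power dominating set $S$, $\operatorname{ppt}_k(G,S)$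 is the smallest $\ell\geq 0$ with $S^{[\ell]}=V(G)$. The $k$-power propagation time of $G$ is $\operatorname{ppt}_k(G)=\min\{\operatorname{ppt}_k(G,S) : S \text{ is a minimum } k\text{-power dominating set of } G\}$. *)

(* Defs.v *)
From mathcomp Require Import all_boot.

Set Implicit Arguments.
Unset Strict Implicit.
Unset Printing Implicit Defensive.

Record sgraph := SGraph {
  vertex :> finType;
  adj : rel vertex;
  adj_sym : symmetric adj;
  adj_irr : irreflexive adj
}.

Definition isom (G H : sgraph) : Prop :=
  exists2 f : G -> H, bijective f & forall x y, adj (f x) (f y) = adj x y.

Definition connected (G : sgraph) : Prop :=
  forall x y : G, connect (@adj G) x y.

Section Propagation.
Variables (k : nat) (G : sgraph).
Implicit Types (S : {set G}) (v : G).

Definition nbrs v : {set G} := [set w | adj v w].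

Definition max_degree : nat := \max_(v : G) #|nbrs v|.

Definition closed_nbrs S : {set G} := S :|: \bigcup_(v in S) nbrs v.

Definition propagate S : {set G} :=
  S :|: [set w | [exists v in S,
                   (w \in nbrs v :\: S) && (#|nbrs v :\: S| <= k)]].

(* [observed S t] is S^[t]: the first step dominates, all later ones force. *)
Definition observed S (t : nat) : {set G} :=
  if t is t'.+1 then iter t' propagate (closed_nbrs S) else S.

(* The bound #|G| on the number of steps is harmless: see [power_dominatingP]. *)
Definition power_dominating S : bool :=
  [exists l : 'I_#|G|.+1, observed S l == [set: G]].

Definition min_power_dominating S : bool :=
  power_dominating S
  && [forall S' : {set G}, power_dominating S' ==> (#|S| <= #|S'|)].

(* Only meaningful for power dominating S: see [ppt_setP]. *)
Definition ppt_set S : nat :=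
  find (fun l => observed S l == [set: G]) (iota 0 #|G|.+1).

Lemma observed_bounded S l :
  observed S l = [set: G] ->
  exists2 m, m <= l & m <= #|G| /\ observed S m = [set: G].
Proof.
move=> Sl; have ex : exists m, observed S m == [set: G] by exists l; apply/eqP.
case: (ex_minnP ex) => m /eqP Sm m_min.
exists m; first by apply: m_min; rewrite Sl.
split=> //; case: (posnP #|G|) => [G0|G_gt0].
  by move: (m_min 0); rewrite G0; apply; rewrite eqEcard subsetT cardsT G0.
case: m Sm m_min => [//|m] Sm m_min.
have [S0|S_gt0] := posnP #|S|.
  have {}S0 : S = set0 by apply/eqP; rewrite -cards_eq0 S0.
  suff E t : observed S t = set0.
    by move: Sm; rewrite E => E0; move: G_gt0; rewrite -cardsT -E0 cards0.
  rewrite S0; case: t => //= t.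
  have -> : closed_nbrs set0 = set0 by rewrite /closed_nbrs big_set0 setU0.
  elim: t => //= t ->; apply/setP=> w; rewrite !inE.
  by apply/negbTE/existsPn => v; rewrite inE.
have lt_step t : t < m -> #|observed S t.+1| < #|observed S t.+2|.
  move=> lt_tm; apply: proper_card; rewrite properE subsetUl /=.
  apply/negP=> sub; have fixp : propagate (observed S t.+1) = observed S t.+1.
    by apply/eqP; rewrite eqEsubset sub subsetUl.
  have stay j : observed S (j + t).+1 = observed S t.+1.
    by elim: j => //= j IHj; move: IHj fixp => /= ->.
  have : m.+1 <= t.+1.
    by apply: m_min; rewrite -(stay (m - t)) subnK ?Sm // ltnW.
  by rewrite ltnS leqNgt lt_tm.
have grow t : t <= m -> t < #|observed S t.+1|.
  elim: t => [|t IHt] tm; last exact: leq_ltn_trans (IHt (ltnW tm)) (lt_step _ tm).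
  exact: leq_trans S_gt0 (subset_leq_card (subsetUl _ _)).
by apply: leq_trans (grow m (leqnn m)) (max_card _).
Qed.

Lemma power_dominatingP S :
  reflect (exists l, observed S l = [set: G]) (power_dominating S).
Proof.
apply: (iffP existsP) => [[l /eqP Sl]|[l /observed_bounded[m _ [mG Sm]]]].
  by exists l.
by exists (Ordinal (mG : m < #|G|.+1)); apply/eqP.
Qed.

Lemma ppt_setP S :
  power_dominating S ->
  observed S (ppt_set S) = [set: G]
  /\ forall l, observed S l = [set: G] -> ppt_set S <= l.
Proof.
move=> /existsP[l0 Sl0]; set a := fun l => observed S l == [set: G].
have ha : has a (iota 0 #|G|.+1).
  by apply/hasP; exists (val l0); rewrite ?mem_iota //= ltn_ord.
have lt_find : ppt_set S < #|G|.+1 by move: ha; rewrite has_find size_iota.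
split; first by apply/eqP; move: (nth_find 0 ha); rewrite nth_iota.
move=> l Sl; rewrite leqNgt; apply/negP=> lt_l.
have := before_find 0 lt_l; rewrite nth_iota ?(ltn_trans lt_l) //.
by rewrite add0n Sl eqxx.
Qed.

Lemma ppt_attained :
  exists l, [exists S, min_power_dominating S && (ppt_set S == l)].
Proof.
have domT : power_dominating [set: G] by apply/power_dominatingP; exists 0.
case: (arg_minnP (fun S => #|S|) domT) => S domS minS.
exists (ppt_set S); apply/existsP; exists S; rewrite eqxx andbT.
by apply/andP; split=> //; apply/forall_inP.
Qed.

(* The least l of the form [ppt_set S] with S minimum. *)
Definition ppt : nat := ex_minn ppt_attained.

End Propagation.

Definition path_adj n : rel 'I_n :=
  fun i j => (i.+1 == j :> nat) || (j.+1 == i :> nat).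
Lemma path_adj_sym n : symmetric (@path_adj n).
Proof. by move=> i j; rewrite /path_adj orbC. Qed.
Lemma path_adj_irr n : irreflexive (@path_adj n).
Proof. by move=> i; rewrite /path_adj orbb gtn_eqF. Qed.
Definition path_graph n := SGraph (@path_adj_sym n) (@path_adj_irr n).

(* [ordS] is the cyclic successor on 'I_n. *)
Definition cycle_adj n : rel 'I_n :=
  fun i j => (i != j) && ((ordS i == j) || (ordS j == i)).
Lemma cycle_adj_sym n : symmetric (@cycle_adj n).
Proof. by move=> i j; rewrite /cycle_adj eq_sym orbC. Qed.
Lemma cycle_adj_irr n : irreflexive (@cycle_adj n).
Proof. by move=> i; rewrite /cycle_adj eqxx. Qed.
Definition cycle_graph n := SGraph (@cycle_adj_sym n) (@cycle_adj_irr n).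

Definition complete_adj n : rel 'I_n := fun i j => i != j.
Lemma complete_adj_sym n : symmetric (@complete_adj n).
Proof. by move=> i j; rewrite /complete_adj eq_sym. Qed.
Lemma complete_adj_irr n : irreflexive (@complete_adj n).
Proof. by move=> i; rewrite /complete_adj eqxx. Qed.
Definition complete_graph n :=
  SGraph (@complete_adj_sym n) (@complete_adj_irr n).

Definition compl_adj (G : sgraph) : rel G := fun x y => (x != y) && ~~ adj x y.
Lemma compl_adj_sym G : symmetric (@compl_adj G).
Proof. by move=> x y; rewrite /compl_adj eq_sym adj_sym. Qed.
Lemma compl_adj_irr G : irreflexive (@compl_adj G).
Proof. by move=> x; rewrite /compl_adj eqxx. Qed.
Definition compl_graph G := SGraph (@compl_adj_sym G) (@compl_adj_irr G).

Definition union_adj (G H : sgraph) : rel (G + H)%type := fun x y =>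
  match x, y with
  | inl a, inl b => adj a b
  | inr a, inr b => adj a b
  | _, _ => false
  end.
Lemma union_adj_sym G H : symmetric (@union_adj G H).
Proof. by move=> [x|x] [y|y] //=; rewrite adj_sym. Qed.
Lemma union_adj_irr G H : irreflexive (@union_adj G H).
Proof. by move=> [x|x] /=; rewrite adj_irr. Qed.
Definition union_graph G H := SGraph (@union_adj_sym G H) (@union_adj_irr G H).

Definition delete_edge_adj (G : sgraph) (a b : G) : rel G :=
  fun x y => adj x y && ([set x; y] != [set a; b]).
Lemma delete_edge_adj_sym G a b : symmetric (@delete_edge_adj G a b).
Proof. by move=> x y; rewrite /delete_edge_adj adj_sym setUC. Qed.
Lemma delete_edge_adj_irr G a b : irreflexive (@delete_edge_adj G a b).
Proof. by move=> x; rewrite /delete_edge_adj adj_irr. Qed.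
Definition delete_edge G a b :=
  SGraph (@delete_edge_adj_sym G a b) (@delete_edge_adj_irr G a b).

(* A new vertex [None], adjacent to [a] only. *)
Definition add_leaf_adj (G : sgraph) (a : G) : rel (option G) := fun x y =>
  match x, y with
  | Some u, Some v => adj u v
  | Some u, None | None, Some u => u == a
  | None, None => false
  end.
Lemma add_leaf_adj_sym G a : symmetric (@add_leaf_adj G a).
Proof. by move=> [x|] [y|] //=; rewrite adj_sym. Qed.
Lemma add_leaf_adj_irr G a : irreflexive (@add_leaf_adj G a).
Proof. by move=> [x|] //=; rewrite adj_irr. Qed.
Definition add_leaf G a :=
  SGraph (@add_leaf_adj_sym G a) (@add_leaf_adj_irr G a).

Definition bipartite_adj m n : rel ('I_m + 'I_n)%type := fun x y =>
  match x, y with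
  | inl _, inr _ | inr _, inl _ => true
  | _, _ => false
  end.
Lemma bipartite_adj_sym m n : symmetric (@bipartite_adj m n).
Proof. by move=> [x|x] [y|y]. Qed.
Lemma bipartite_adj_irr m n : irreflexive (@bipartite_adj m n).
Proof. by move=> [x|x]. Qed.
Definition complete_bipartite m n :=
  SGraph (@bipartite_adj_sym m n) (@bipartite_adj_irr m n).

Definition K4_minus_edge : sgraph :=
  @delete_edge (complete_graph 4) (@ord0 3) (@ord_max 3).

Definition L31 : sgraph := @add_leaf (complete_graph 3) (@ord0 2).

Definition frakG (G : sgraph) : Prop :=
  [/\ connected G, #|G| = 5 & max_degree G = 3].

(* Main.v *)
Require Import Defs.
From mathcomp Require Import all_boot zify.

Set Implicit Arguments.
Unset Strict Implicit.
Unset Printing Implicit Defensive.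

(** Let [S] be a minimum k-power dominating set. Every stage [S^[t]] before the
    last one is strictly smaller than the next, so a stage that adds several
    vertices at once saves time: [ppt_set S + #|S^[t]| <= n + t]. When the
    propagation time is [n - 3] this leaves [#|S^[t]| <= t + 3] for every
    minimum [S] and every [t] ([card_observed]); in particular [#|S| <= 3], and
    the vertices of [S] have degree at most 3.

    The main step is that [S] can be moved. If [v] in [S] has degree at most
    [k + 1], replacing [v] by a neighbor [w] loses nothing: [v] is observed at
    time 1, and having its neighbor [w] already observed it forces all its other
    neighbors at time 2. Since [3 <= k + 1], repeated swaps carry [v] to any
    vertex of its component ([optimal_move]). Consequently every vertex lies in
    some minimum set, so the whole graph has maximum degree at most 3
    ([degree_le3]), every observed vertex passes the observation on to all its
    neighbors ([nbrs_observed]), and [S] has exactly one vertex in each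
    component ([optimal_unlinked]). From here on [S^[t]] is the ball of radius
    [t] around [S], and the bound [#|S^[t]| <= t + 3] holds for every choice of
    one center per component.

    - One component. If some vertex has degree 3, a graph with six or more
      vertices would have a ball of radius 2 with six vertices
      ([card_of_degree3]), so there are at most five vertices. Otherwise all
      degrees are at most 2, so a path visits every vertex ([covering_path]) and
      the graph is a path or a cycle ([path_or_cycle]); the ball of radius 3
      around the fourth vertex of the path leaves at most six vertices.
    - Two components. If both have an edge, a second edge in either of them
      gives five vertices at distance at most 1 from suitable centers. If one
      is a single vertex, the other has maximum degree at most 2 and is a path or a cycle,
      with at most four vertices by the same ball argument.
    - Three components. There is room for at most one edge. *)

(** * Propagation from an arbitrary set *)

Section Observed.

Variables (k : nat) (G : sgraph).
Implicit Types (S T X : {set G}) (v w x y z : G).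

Lemma propagate_mono S T : S \subset T -> propagate k S \subset propagate k T.
Proof.
move=> sub; apply/subsetP=> w; rewrite !inE.
case/orP=> [/(subsetP sub)->//|/existsP[v]]; rewrite !inE.
case/and3P=> vS /andP[_ vw] le_k; case: (w \in T) / boolP => //= wT.
apply/existsP; exists v; rewrite !inE (subsetP sub) // vw wT /=.
by apply: leq_trans le_k; apply/subset_leq_card/setDS.
Qed.

Lemma propagate_sub_closed_nbrs S : propagate k S \subset closed_nbrs S.
Proof.
apply/setUS/subsetP=> w; rewrite inE => /existsP[v].
rewrite !inE => /and3P[vS /andP[_ vw] _].
by apply/bigcupP; exists v; rewrite ?inE.
Qed.

Lemma observed_subS S t : observed k S t \subset observed k S t.+1.
Proof. by case: t => [|t]; apply: subsetUl. Qed.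

Lemma observed_sub S t u : t <= u -> observed k S t \subset observed k S u.
Proof.
move/subnK <-; elim: (u - t) => // i IHi.
exact: subset_trans IHi (observed_subS _ _).
Qed.

Lemma nbrs_sub_observed1 S v t :
  v \in S -> nbrs v \subset observed k S t.+1.
Proof.
move=> vS; apply: subset_trans (observed_sub S (ltn0Sn t)).
by apply: subset_trans (subsetUr _ _); apply: (bigcup_sup v).
Qed.

Lemma mem_observed S v t : v \in S -> v \in observed k S t.
Proof. by apply/subsetP/(observed_sub S (leq0n t)). Qed.

(** A stage that adds nothing is final, so every stage before the last adds a
    vertex; from stage [t] on, at most [#|G| - #|S^[t]|] steps remain. *)
Lemma ppt_set_card S t :
  power_dominating k S -> ppt_set k S + #|observed k S t| <= #|G| + t.
Proof.
move=> domS; have [full least] := ppt_setP domS.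
have [le_t|lt_t] := leqP (ppt_set k S) t.
  by rewrite addnC leq_add ?max_card.
have stay i u : observed k S u.+1 = observed k S u ->
    observed k S (i + u) = observed k S u.
  move=> fix_u; have step : propagate k (observed k S u) = observed k S u.
    case: u fix_u => // fix0; apply/eqP; rewrite eqEsubset subsetUl andbT.
    have := propagate_sub_closed_nbrs S.
    by rewrite (fix0 : closed_nbrs S = S).
  elim: i => // i IHi; case: u fix_u step IHi => [|u] fix_u step IHi.
    rewrite !addn0 in IHi *; case: i IHi => // i IHi.
    by rewrite -[LHS]/(propagate k (observed k S i.+1)) IHi.
  rewrite !addnS in IHi *; rewrite -[LHS]/(propagate k (observed k S (i + u).+1)).
  by rewrite IHi.
have grow i : i + t <= ppt_set k S ->
    i + #|observed k S t| <= #|observed k S (i + t)|.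
  elim: i => // i IHi lt_i; apply: leq_ltn_trans (IHi (ltnW lt_i)) _.
  apply/proper_card; rewrite properEneq observed_subS andbT.
  apply: contraTneq lt_i => /esym fix_i; rewrite -ltnNge addSn ltnS; apply: least.
  have [le_i|/ltnW lt_i] := leqP (ppt_set k S) (i + t).
    by apply/eqP; rewrite -subTset -full observed_sub.
  by rewrite -full -(stay (ppt_set k S - (i + t)) _ fix_i) subnK.
have := grow (ppt_set k S - t); rewrite subnK ?(ltnW lt_t) // full cardsT.
by move=> /(_ (leqnn _)); rewrite -(leq_add2r t) addnAC subnK // ltnW.
Qed.

Lemma observed_nbr S x t :
  x \in observed k S t -> x \notin S ->
  exists2 y, y \in observed k S t & adj x y.
Proof.
elim: t => [-> //|t IHt] xt xS.
have [old|new] := boolP (x \in observed k S t).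
  by have [y yt xy] := IHt old xS; exists y; rewrite // (subsetP (observed_subS S t)).
case: t xt new {IHt} => [|t]; rewrite /= !inE => /orP[->//|].
  case/bigcupP=> y yS; rewrite inE => yx _; exists y; last by rewrite adj_sym.
  exact: (mem_observed 1).
case/existsP=> y; rewrite !inE => /and3P[yt /andP[_ yx] _] _.
by exists y; [rewrite (subsetP (subsetUl _ _)) | rewrite adj_sym].
Qed.

Lemma observed_connect S x t :
  x \in observed k S t -> exists2 s, s \in S & connect (@adj G) s x.
Proof.
elim: t x => [|t IHt] x; first by exists x.
have from_nbr y : y \in observed k S t -> adj y x ->
    exists2 s, s \in S & connect (@adj G) s x.
  by move=> /IHt[s sS sy] /connect1; exists s => //; apply: connect_trans sy _.
case: t IHt from_nbr => [|t] IHt from_nbr; rewrite /= inE => /orP[/IHt//|].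
  by case/bigcupP=> y yS; rewrite inE; apply: from_nbr.
by rewrite inE => /existsP[y]; rewrite !inE => /and3P[yt /andP[_ yx] _];
   apply: from_nbr yx.
Qed.

(** A vertex observed by a neighbor has that neighbor observed, so with degree
    at most [k + 1] it has at most [k] neighbors left and forces all of them. *)
Lemma nbrs_observedS S x t :
  #|nbrs x| <= k.+1 -> x \in observed k S t ->
  nbrs x \subset observed k S t.+1.
Proof.
move=> deg_x xt; have [xS|xS] := boolP (x \in S).
  exact: nbrs_sub_observed1.
have [y yt xy] := observed_nbr xt xS.
case: t xt yt => [|t] xt yt; first by rewrite xt in xS.
set O := observed k S t.+1 in xt yt *.
apply/subsetP=> w xw; rewrite -[observed _ _ _]/(propagate k O) inE -implyNb.
apply/implyP=> wO; rewrite inE; apply/existsP; exists x.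
rewrite xt inE wO xw /= -ltnS (leq_trans _ deg_x) //.
apply/proper_card; rewrite properE subsetDl; apply/subsetPn.
by exists y; rewrite !inE ?xy ?yt.
Qed.

(** The new set recovers [v] and then all neighbors of [v] within two steps,
    hence everything that the old set observes in its first step. *)
Lemma swap_power_dominating S v w :
  power_dominating k S -> v \in S -> adj v w -> #|nbrs v| <= k.+1 ->
  power_dominating k (w |: S :\ v).
Proof.
move=> /power_dominatingP[l Sl] vS vw deg_v; set S' := w |: S :\ v.
have wS' : w \in S' by rewrite !inE eqxx.
have v1 : v \in observed k S' 1.
  by apply: (subsetP (nbrs_sub_observed1 0 wS')); rewrite inE adj_sym.
have sub2 : observed k S 1 \subset observed k S' 2.
  apply/subsetP=> x; case/setUP=> [xS|/bigcupP[y yS]].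
    have [->|xv] := eqVneq x v; first exact: (subsetP (observed_subS _ _)).
    by apply: (@mem_observed _ _ 2); rewrite !inE xv xS orbT.
  have [->|yv] := eqVneq y v; first exact/subsetP/nbrs_observedS.
  by apply/subsetP/(nbrs_sub_observed1 1); rewrite !inE yv yS orbT.
have sub t : observed k S t.+1 \subset observed k S' t.+2.
  by elim: t => //= t; apply: propagate_mono.
apply/power_dominatingP; exists l.+2; apply/eqP.
rewrite eqEsubset subsetT -Sl.
by apply: subset_trans (sub l); apply: observed_subS.
Qed.

Lemma crossing_edge X x y :
  connect (@adj G) x y -> x \in X -> y \notin X ->
  exists w z, [/\ w \in X, z \notin X & adj w z].
Proof.
case/connectP=> p; elim: p x => [|z p IHp] x /=; first by move=> _ -> ->.
case/andP=> xz zp y_last xX yX; have [zX|zX] := boolP (z \in X).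
  exact: IHp zp y_last zX yX.
by exists x, z.
Qed.

Lemma ppt_min S : min_power_dominating k S -> ppt k G <= ppt_set k S.
Proof.
move=> minS; rewrite /ppt; case: ex_minnP => l _; apply.
by apply/existsP; exists S; rewrite minS eqxx.
Qed.

Lemma ppt_witness :
  exists2 S, min_power_dominating k S & observed k S (ppt k G) = [set: G].
Proof.
rewrite /ppt; case: ex_minnP => l /existsP[S /andP[minS /eqP<-]] _.
by exists S => //; case/andP: minS => /ppt_setP[].
Qed.

Lemma min_power_dominating_le S T :
  min_power_dominating k S -> power_dominating k T -> #|T| <= #|S| ->
  min_power_dominating k T /\ #|T| = #|S|.
Proof.
case/andP=> domS /forallP minS domT le_TS.
have minT (U : {set G}) : power_dominating k U -> #|S| <= #|U| by apply/implyP.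
split; last by apply/eqP; rewrite eqn_leq le_TS minT.
rewrite /min_power_dominating domT; apply/forall_inP=> U /minT.
exact: leq_trans.
Qed.

End Observed.

(** * Recognizing a graph *)

(** The upper triangle of the adjacency matrix of [s], row by row. For explicit
    lists it computes, which reduces an isomorphism to one rewrite. *)
Fixpoint adjacencies (G : sgraph) (s : seq G) : seq bool :=
  if s is x :: s' then [seq adj x y | y <- s'] ++ adjacencies s' else [::].

Section Isomorphisms.

Variables G H : sgraph.

Lemma isom_of_embedding (f : H -> G) :
  injective f -> #|G| <= #|H| -> (forall x y, adj (f x) (f y) = adj x y) ->
  isom G H.
Proof.
move=> inj_f le_GH adj_f; have [g fK gK] := inj_card_bij inj_f le_GH.
by exists g; [exists f | move=> x y; rewrite -adj_f !gK].
Qed.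

Lemma isom_of_lists (x0 : G) (y0 : H) (s : seq G) (t : seq H) :
  uniq s -> uniq t -> size s = #|G| -> size s = #|H| -> size s = size t ->
  adjacencies s = adjacencies t -> isom G H.
Proof.
move=> Us Ut cardG cardH size_t eq_adj.
have adj_st i j : i < j < size s ->
    adj (nth x0 s i) (nth x0 s j) = adj (nth y0 t i) (nth y0 t j).
  elim: s t size_t eq_adj i j {Us Ut cardG cardH} => [|x s IHs] [|y t] //=.
    by move=> _ _ i j; rewrite andbF.
  case=> size_t /eqP; rewrite eqseq_cat ?size_map // => /andP[/eqP eq_x /eqP eq_s].
  case=> [|i] [|j] //= lt_ij; last exact: IHs.
  by rewrite -(nth_map _ false) // eq_x (nth_map y0) -?size_t.
have t_all y : y \in t.
  have card_t : #|t| = #|H| by rewrite (card_uniqP Ut) -size_t.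
  by rewrite (subset_cardP card_t (subset_predT _)).
have lt_index y : index y t < size s by rewrite size_t index_mem.
apply: (@isom_of_embedding (fun y => nth x0 s (index y t))).
- move=> y z /eqP; rewrite nth_uniq // => /eqP eq_i.
  by rewrite -[y](nth_index y0 (t_all y)) eq_i nth_index.
- by rewrite -cardG cardH.
move=> y z; have sorted_case y' z' : index y' t < index z' t ->
    adj (nth x0 s (index y' t)) (nth x0 s (index z' t)) = adj y' z'.
  by move=> lt_i; rewrite adj_st ?lt_i ?lt_index ?nth_index.
case: (ltngtP (index y t) (index z t)) => [/sorted_case//|/sorted_case eq_a|eq_i].
  by rewrite adj_sym eq_a adj_sym.
by rewrite -[y](nth_index y0 (t_all y)) eq_i nth_index // !adj_irr.
Qed.

End Isomorphisms.

(** * Connected graphs of maximum degree 2 *)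

Lemma card_ge_uniq (T : finType) (A : {set T}) (s : seq T) :
  uniq s -> {subset s <= A} -> size s <= #|A|.
Proof. by move=> /card_uniqP <- /subsetP/subset_leq_card. Qed.

Section CoveringPath.

Variable G : sgraph.
Implicit Types (r x y z : G) (p : seq G).

Lemma degree_ge3 x y1 y2 y3 :
  uniq [:: y1; y2; y3] -> adj x y1 -> adj x y2 -> adj x y3 -> 2 < #|nbrs x|.
Proof.
move=> U xy1 xy2 xy3; apply: (card_ge_uniq U) => z.
by rewrite !inE => /or3P[] /eqP->.
Qed.

(** A path that misses part of the component can be extended: the component has
    an edge leaving the path, and this edge starts at an end of the path because
    an interior vertex has used up its two neighbors. *)
Lemma covering_path r :
  (forall x, connect (@adj G) r x -> #|nbrs x| <= 2) ->
  exists p, [/\ uniq p, sorted (@adj G) p & p =i connect (@adj G) r].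
Proof.
move=> deg2.
pose good p := [/\ uniq p, sorted (@adj G) p, r \in p
                 & {subset p <= connect (@adj G) r}].
suff ext m : exists2 p, good p &
    (m <= size p) || [forall x, connect (@adj G) r x ==> (x \in p)].
  have [p [Up adj_p rp sub_p]] := ext #|G|.+1.
  rewrite leqNgt -(card_uniqP Up) ltnS max_card /= => /forall_inP all_p.
  by exists p; split=> // x; apply/idP/idP; [apply: sub_p | apply: all_p].
elim: m => [|m [p good_p]].
  exists [:: r] => //; split; rewrite ?inE //.
  by move=> x; rewrite inE => /eqP->; apply: connect0.
case/orP=> [le_m|full]; last by exists p; rewrite ?full ?orbT.
have [full|/forall_inPn[y ry yp]] :=
  boolP [forall x, connect (@adj G) r x ==> (x \in p)].
  by exists p; rewrite ?full ?orbT.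
case: good_p => Up adj_p rp sub_p.
have [||w [z [wp zp wz]]] := @crossing_edge G [set x in p] r y ry; rewrite ?inE //.
rewrite !inE in wp zp.
have rw := sub_p w wp; have rz : connect (@adj G) r z.
  by apply: connect_trans rw (connect1 wz).
have ext q : perm_eq q (z :: p) -> sorted (@adj G) q -> exists2 p, good p &
    (m < size p) || [forall x, connect (@adj G) r x ==> (x \in p)].
  move=> eq_q adj_q; exists q; last by rewrite (perm_size eq_q) /= ltnS le_m.
  split=> //; first by rewrite (perm_uniq eq_q) /= zp.
    by rewrite (perm_mem eq_q) inE rp orbT.
  by move=> x; rewrite (perm_mem eq_q) inE => /predU1P[->//|/sub_p].
case/splitPr: {rp le_m sub_p} wp Up adj_p zp ext => s1 s2 Up adj_p zp ext.
case: s2 Up adj_p zp ext => [|b s2] Up adj_p zp ext.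
  apply: (ext (rcons (rcons s1 w) z)); first by rewrite perm_rcons cats1.
  move: adj_p; rewrite cats1; case: (s1) => [|c s] /=; rewrite ?wz //.
  by rewrite !rcons_path last_rcons wz andbT.
case/lastP: s1 Up adj_p zp ext => [|s1 a] Up adj_p zp ext.
  by apply: (ext (z :: w :: b :: s2)) => //=; rewrite adj_sym wz.
move: adj_p; rewrite cat_rcons => /cat_sorted2[_ /and3P[aw wb _]].
suff : 2 < #|nbrs w| by rewrite ltnNge deg2.
apply: (@degree_ge3 w a b z) => //; last by rewrite adj_sym.
move: Up zp; rewrite cat_rcons cat_uniq mem_cat !inE /= !inE !negb_or.
case/and3P=> _ _ /andP[/and3P[_ ab _] _] /and5P[_ za _ zb _].
by rewrite ab eq_sym za eq_sym zb.
Qed.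

(** Interior vertices of the path already have two neighbors on it, so a chord
    can only join its two ends. *)
Lemma path_chord x0 p i j :
  uniq p -> sorted (@adj G) p -> (forall x, x \in p -> #|nbrs x| <= 2) ->
  i < j < size p ->
  adj (nth x0 p i) (nth x0 p j) =
    (j == i.+1) || [&& i == 0, j.+1 == size p & adj (nth x0 p 0) (nth x0 p j)].
Proof.
move=> Up /(sortedP x0) adj_p deg2 /andP[lt_ij lt_j].
have [->|ne_j] /= := eqVneq j i.+1; first by rewrite adj_p //; lia.
have no3 l a b c : [&& a < l, l < b, b < size p, c < size p, c != a & c != b] ->
    adj (nth x0 p l) (nth x0 p a) -> adj (nth x0 p l) (nth x0 p b) ->
    adj (nth x0 p l) (nth x0 p c) = false.
  move=> lt_abc adj_a adj_b; apply/negP=> adj_c.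
  have [lt_a lt_b lt_c] : [/\ a < size p, b < size p & c < size p] by split; lia.
  have : 2 < #|nbrs (nth x0 p l)|.
    by apply: degree_ge3 adj_a adj_b adj_c; rewrite /= !inE !nth_uniq //; lia.
  rewrite ltnNge deg2 // mem_nth //; apply: leq_trans lt_b; lia.
case: i => [|i] /= in lt_ij ne_j *.
  have [//|lt_jS] /= := eqVneq j.+1 (size p).
  rewrite adj_sym; apply: (no3 j j.-1 j.+1); [lia | | by apply: adj_p; lia].
  by have := adj_p j.-1; rewrite (ltn_predK lt_ij) adj_sym; apply.
by apply: (no3 i.+1 i i.+2); [lia | rewrite adj_sym adj_p | apply: adj_p]; lia.
Qed.

Lemma path_or_cycle x0 p m :
  uniq p -> sorted (@adj G) p -> (forall x, x \in p -> #|nbrs x| <= 2) ->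
  size p = m -> 2 < m ->
  (forall i j : 'I_m, adj (nth x0 p i) (nth x0 p j) = path_adj i j) \/
  (forall i j : 'I_m, adj (nth x0 p i) (nth x0 p j) = cycle_adj i j).
Proof.
move=> Up adj_p deg2 size_p gt2m.
have reduce (H : rel 'I_m) : symmetric H -> irreflexive H ->
    (forall i j : 'I_m, i < j -> adj (nth x0 p i) (nth x0 p j) = H i j) ->
    forall i j : 'I_m, adj (nth x0 p i) (nth x0 p j) = H i j.
  move=> symH irrH eqH i j; case: (ltngtP i j) => [/eqH//|/eqH|/val_inj->].
    by rewrite adj_sym symH.
  by rewrite adj_irr irrH.
have chord (i j : 'I_m) : i < j -> adj (nth x0 p i) (nth x0 p j) =
    (j == i.+1 :> nat) || [&& i == 0 :> nat, j.+1 == m & adj (nth x0 p 0) (nth x0 p m.-1)].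
  move=> lt_ij; rewrite (path_chord x0) ?lt_ij ?size_p ?ltn_ord //.
  by have [def_m|] := eqVneq j.+1 m; rewrite // -(congr1 predn def_m).
case: (adj (nth x0 p 0) _) in chord *; [right | left]; apply: reduce.
- exact: cycle_adj_sym.
- exact: cycle_adj_irr.
- move=> i j lt_ij; rewrite chord // andbT /cycle_adj -val_eqE /= (ltn_eqF lt_ij) /=.
  rewrite -[ordS i == j]val_eqE -[ordS j == i]val_eqE /=.
  rewrite modn_small ?(leq_ltn_trans lt_ij) // eq_sym; congr (_ || _).
  have [->|lt_j] := eqVneq j.+1 m; first by rewrite modnn andbT eq_sym.
  have lt_jm := ltn_ord j; rewrite andbF modn_small; lia.
- exact: path_adj_sym.
- exact: path_adj_irr.
by move=> i j lt_ij; rewrite chord // !andbF orbF /path_adj; lia.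
Qed.

End CoveringPath.

(** * The graphs of the list *)

Lemma enum_set3 (T : finType) (A : {set T}) :
  #|A| = 3 -> exists x y z, uniq [:: x; y; z] /\ A =i [:: x; y; z].
Proof.
move=> card3; have := enum_uniq A; have := mem_enum A; rewrite cardE in card3.
case: (enum A) card3 => [|x [|y [|z [|? ?]]]] // _ memA U.
by exists x, y, z; split=> // w; rewrite memA.
Qed.

Section SmallGraphs.

Variable G : sgraph.
Implicit Types u a b c r s x y z : G.

Lemma delete_edge_adjE (H : sgraph) (e f x y : H) :
  delete_edge_adj e f x y =
    adj x y && ~~ ((x == e) && (y == f) || (x == f) && (y == e)).
Proof.
rewrite /delete_edge_adj; congr (_ && ~~ _); apply/eqP/idP.
  move=> /setP eq_set; have := eq_set e; have := eq_set f.
  have := eq_set x; have := eq_set y; rewrite !inE !eqxx !orbT /=.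
  rewrite [e == x]eq_sym [f == y]eq_sym [e == y]eq_sym [f == x]eq_sym.
  by do 4!case: eqP => //= _.
by case/orP=> /andP[/eqP-> /eqP->] //; rewrite setUC.
Qed.

Local Notation o m i := (@Ordinal m i isT).

Lemma isom_K13 u a b c :
  uniq [:: u; a; b; c] -> #|G| = 4 -> adj u a -> adj u b -> adj u c ->
  ~~ adj a b -> ~~ adj a c -> ~~ adj b c -> isom G (complete_bipartite 1 3).
Proof.
move=> U card4 ua ub uc /negbTE ab /negbTE ac /negbTE bc.
apply: (@isom_of_lists G (complete_bipartite 1 3) u (inl ord0) [:: u; a; b; c]
  [:: inl ord0; inr (o 3 0); inr (o 3 1); inr (o 3 2)]) => //=.
  by rewrite card_sum !card_ord.
by rewrite ua ub uc ab ac bc.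
Qed.

Lemma isom_L31 u a b c :
  uniq [:: u; a; b; c] -> #|G| = 4 -> adj u a -> adj u b -> adj u c ->
  adj a b -> ~~ adj a c -> ~~ adj b c -> isom G L31.
Proof.
move=> U card4 ua ub uc ab /negbTE ac /negbTE bc.
apply: (@isom_of_lists G L31 u None [:: u; a; b; c]
  [:: Some (o 3 0); Some (o 3 1); Some (o 3 2); None]) => //=.
  by rewrite card_option !card_ord.
by rewrite ua ub uc ab ac bc.
Qed.

Lemma isom_K4_minus_edge u a b c :
  uniq [:: u; a; b; c] -> #|G| = 4 -> adj u a -> adj u b -> adj u c ->
  adj a b -> ~~ adj a c -> adj b c -> isom G K4_minus_edge.
Proof.
move=> U card4 ua ub uc ab /negbTE ac bc.
apply: (@isom_of_lists G K4_minus_edge u ord0 [:: u; a; b; c]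
  [:: o 4 1; o 4 0; o 4 2; o 4 3]) => //=.
  by rewrite card_ord.
by rewrite !delete_edge_adjE ua ub uc ab ac bc.
Qed.

Lemma isom_K4 u a b c :
  uniq [:: u; a; b; c] -> #|G| = 4 -> adj u a -> adj u b -> adj u c ->
  adj a b -> adj a c -> adj b c -> isom G (complete_graph 4).
Proof.
move=> U card4 ua ub uc ab ac bc.
apply: (@isom_of_lists G (complete_graph 4) u ord0 [:: u; a; b; c]
  [:: o 4 0; o 4 1; o 4 2; o 4 3]) => //=.
  by rewrite card_ord.
by rewrite ua ub uc ab ac bc.
Qed.

Lemma four_vertices_degree3 u :
  #|G| = 4 -> #|nbrs u| = 3 ->
  [\/ isom G (complete_bipartite 1 3), isom G L31, isom G K4_minus_edge
    | isom G (complete_graph 4)].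
Proof.
move=> card4 /enum_set3[a [b [c [U nbrs_u]]]].
have Nu x : x \in [:: a; b; c] -> adj u x by rewrite -nbrs_u inE.
have {U} : uniq [:: u; a; b; c] by rewrite cons_uniq U -nbrs_u inE adj_irr.
have [ua ub uc] : [/\ adj u a, adj u b & adj u c].
  by split; apply: Nu; rewrite !inE eqxx ?orbT.
have rot x y z : uniq [:: u; x; y; z] -> uniq [:: u; y; z; x].
  rewrite (perm_uniq (_ : perm_eq _ [:: u; y; z; x])) // perm_cons perm_sym.
  by rewrite (perm_rot 1 [:: x; y; z]).
(* Up to rotation of [a], [b], [c], their adjacencies form four patterns. *)
move=> Uabc; have Ubca := rot _ _ _ Uabc; have Ucab := rot _ _ _ Ubca.
have [ab|ab] := boolP (adj a b); have [ac|ac] := boolP (adj a c);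
  have [bc|bc] := boolP (adj b c); move: (ab) (ac) (bc);
  rewrite adj_sym => ba; rewrite adj_sym => ca; rewrite adj_sym => cb.
- by constructor 4; apply: (isom_K4 Uabc).
- by constructor 3; apply: (isom_K4_minus_edge Ucab).
- by constructor 3; apply: (isom_K4_minus_edge Uabc).
- by constructor 2; apply: (isom_L31 Uabc).
- by constructor 3; apply: (isom_K4_minus_edge Ubca).
- by constructor 2; apply: (isom_L31 Ucab).
- by constructor 2; apply: (isom_L31 Ubca).
by constructor 1; apply: (isom_K13 Uabc).
Qed.

Section PathOrCycle.

Variables (p : seq G) (m : nat).
Hypotheses (Up : uniq p) (adj_p : sorted (@adj G) p).
Hypotheses (deg2 : forall x, x \in p -> #|nbrs x| <= 2).
Hypotheses (size_p : size p = m) (m_gt2 : 2 < m).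

Lemma isom_path_or_cycle :
  #|G| = m -> isom G (path_graph m) \/ isom G (cycle_graph m).
Proof.
move=> cardG; have [x0 _] : exists x0, x0 \in p.
  by case: (p) size_p m_gt2 => [<-|x0 ?] // _ _; exists x0; rewrite mem_head.
have inj_f : injective (fun i : 'I_m => nth x0 p i).
  by move=> i j /eqP; rewrite nth_uniq ?size_p // => /eqP/val_inj.
case: (path_or_cycle x0 Up adj_p deg2 size_p m_gt2) => adj_f; [left | right].
  by apply: (@isom_of_embedding G (path_graph m) _ inj_f); rewrite ?cardG ?card_ord.
by apply: (@isom_of_embedding G (cycle_graph m) _ inj_f); rewrite ?cardG ?card_ord.
Qed.

Lemma isom_K1_path_or_cycle s :
  s \notin p -> (forall x, ~~ adj s x) -> #|G| = m.+1 ->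
  isom G (union_graph (complete_graph 1) (path_graph m)) \/
  isom G (union_graph (complete_graph 1) (cycle_graph m)).
Proof.
move=> sp iso_s cardG.
pose f (i : 'I_1 + 'I_m) : G := if i is inr j then nth s p j else s.
have mem_f (j : 'I_m) : nth s p j != s.
  by apply: contraNneq sp => <-; rewrite mem_nth ?size_p.
have inj_f : injective f.
  case=> i [] j //=; rewrite ?ord1 // => eq_f.
  - by have := mem_f j; rewrite -eq_f eqxx.
  - by have := mem_f i; rewrite eq_f eqxx.
  by move/eqP: eq_f; rewrite nth_uniq ?size_p // => /eqP/val_inj->.
have adj_s x : adj s x = false by apply/negbTE.
have card_f : #|G| <= #|{: 'I_1 + 'I_m}| by rewrite card_sum !card_ord cardG.
case: (path_or_cycle s Up adj_p deg2 size_p m_gt2) => adj_f; [left | right].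
  apply: (@isom_of_embedding G (union_graph (complete_graph 1) (path_graph m)) f) => //.
  by case=> i [] j /=; rewrite ?adj_f // ?(adj_sym _ s) adj_s // !ord1.
apply: (@isom_of_embedding G (union_graph (complete_graph 1) (cycle_graph m)) f) => //.
by case=> i [] j /=; rewrite ?adj_f // ?(adj_sym _ s) adj_s // !ord1.
Qed.

End PathOrCycle.

End SmallGraphs.

(** * Minimum sets when the propagation time is n - 3 *)

Section Extremal.

Variables (k : nat) (G : sgraph).
Hypotheses (k_gt1 : 1 < k) (pptG : ppt k G + 3 = #|G|).
Implicit Types (S : {set G}) (p q r s u v w x y z : G).

Local Notation optimal := (@min_power_dominating k G).
Local Notation linked := (connect (@adj G)).

Lemma linked_sym : symmetric linked.
Proof. exact/sym_connect_sym/adj_sym. Qed.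

Lemma card_observed S t : optimal S -> #|observed k S t| <= t + 3.
Proof.
move=> optS; have /andP[domS _] := optS.
have := ppt_set_card t domS; have := ppt_min optS; lia.
Qed.

Lemma card_optimal_nbrs S v : optimal S -> v \in S -> #|S :|: nbrs v| <= 4.
Proof.
move=> optS vS; apply: leq_trans (card_observed 1 optS).
apply/subset_leq_card; rewrite subUset nbrs_sub_observed1 // andbT.
exact: observed_sub (leq0n 1).
Qed.

Lemma optimal_degree S v : optimal S -> v \in S -> #|nbrs v| <= 3.
Proof.
move=> optS vS; rewrite -ltnS; apply: leq_trans (card_optimal_nbrs optS vS).
apply: leq_trans (subset_leq_card (setSU (nbrs v) (_ : [set v] \subset S))).
  by rewrite cardsU1 inE adj_irr.
by rewrite sub1set.
Qed.

(** The new set cannot be smaller than [S], which is why [w] is a new vertex. *)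
Lemma optimal_swap S v w :
  optimal S -> v \in S -> adj v w ->
  w \notin S :\ v /\ optimal (w |: S :\ v).
Proof.
move=> optS vS vw; have /andP[domS _] := optS.
have deg_v : #|nbrs v| <= k.+1 := leq_trans (optimal_degree optS vS) (k_gt1 : 2 < k.+1).
have domT := swap_power_dominating domS vS vw deg_v.
have [|optT] := min_power_dominating_le optS domT.
  by rewrite cardsU1 (cardsD1 v S) vS leq_add2r leq_b1.
by rewrite cardsU1 (cardsD1 v S) vS => /addIn; case: (w \notin S :\ v).
Qed.

Lemma optimal_move S v x :
  optimal S -> v \in S -> linked v x -> optimal (x |: S :\ v).
Proof.
move=> optS vS /connectP[p path_p ->]; elim: p v S optS vS path_p => [|w p IHp] v S optS vS /=.
  by rewrite setD1K.
case/andP=> vw path_p; have [wS optT] := optimal_swap optS vS vw.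
by have := IHp w _ optT (setU11 _ _) path_p; rewrite setU1K.
Qed.

(** Otherwise one of the two could be moved onto the other, giving a smaller
    power dominating set. *)
Lemma optimal_unlinked S v x :
  optimal S -> v \in S -> x \in S -> v != x -> ~~ linked v x.
Proof.
move=> optS vS xS ne_vx; apply/negP=> vx.
have /andP[domT _] := optimal_move optS vS vx.
have sub : x |: S :\ v = S :\ v.
  by apply/setUidPr; rewrite sub1set !inE eq_sym ne_vx.
rewrite sub in domT; have [|_] := min_power_dominating_le optS domT.
  by rewrite subset_leq_card ?subsetDl.
by rewrite (cardsD1 v S) vS => /esym/eqP; rewrite -[X in _ == X]add0n eqn_add2r.
Qed.

Lemma optimal_linked S x : optimal S -> exists2 s, s \in S & linked s x.
Proof.
case/andP=> /power_dominatingP[l Sl] _.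
by apply: (@observed_connect k _ S x l); rewrite Sl.
Qed.

Lemma optimal_containing S x :
  optimal S -> exists T, [/\ optimal T, x \in T & #|T| = #|S|].
Proof.
move=> optS; have [s sS sx] := optimal_linked x optS.
have optT := optimal_move optS sS sx; exists (x |: S :\ s).
have /andP[domT _] := optT; split=> //; first exact: setU11.
have [|_ //] := min_power_dominating_le optS domT.
by rewrite cardsU1 (cardsD1 s S) sS leq_add2r leq_b1.
Qed.

Lemma degree_le3 x : #|nbrs x| <= 3.
Proof.
have [S optS _] := ppt_witness k G.
have [T [optT xT _]] := optimal_containing x optS.
exact: optimal_degree optT xT.
Qed.

Lemma nbrs_observed S x y t :
  x \in observed k S t -> adj x y -> y \in observed k S t.+1.
Proof.
move=> xt xy; have deg_x : #|nbrs x| <= k.+1 := leq_trans (degree_le3 x) (k_gt1 : 2 < k.+1).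
by apply: (subsetP (nbrs_observedS deg_x xt)); rewrite inE.
Qed.

Lemma size_observed S (l : seq G) t :
  optimal S -> uniq l -> {subset l <= observed k S t} -> size l <= t + 3.
Proof.
by move=> /(card_observed t) le_t U /(card_ge_uniq U) /leq_trans; apply.
Qed.

Lemma linked_nbr x y z : linked x y -> adj y z -> linked x z.
Proof. by move=> xy /connect1; apply: connect_trans. Qed.

Lemma adj_neq x y : adj x y -> x != y.
Proof. by apply: contraTneq => ->; rewrite adj_irr. Qed.

Lemma unlinked_neq x y z : linked x y -> ~~ linked x z -> y != z.
Proof. by move=> xy; apply: contraNneq => <-. Qed.

(** [S] meets every component, so [X] is a union of components that omits none. *)
Lemma closed_covers S (X : {set G}) :
  optimal S -> S \subset X -> (forall w z, w \in X -> adj w z -> z \in X) ->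
  X = [set: G].
Proof.
move=> optS /subsetP sub closedX; apply/eqP; rewrite -subTset.
apply/subsetP=> x _; have [s sS sx] := optimal_linked x optS.
apply/negPn/negP=> xX; have [w [z [wX zX wz]]] := crossing_edge sx (sub s sS) xX.
by rewrite (closedX w z) in zX.
Qed.

(** * One component *)

Section OneObserver.

Variable s0 : G.
Hypotheses (opt1 : optimal [set s0])
           (full1 : observed k [set s0] (ppt k G) = [set: G]).

Lemma all_linked x y : linked x y.
Proof.
have from_s0 z : linked s0 z.
  by have [s] := optimal_linked z opt1; rewrite inE => /eqP->.
by apply: connect_trans (from_s0 y); rewrite linked_sym from_s0.
Qed.

Lemma optimal1 x : optimal [set x].
Proof.
have := optimal_move opt1 (set11 s0) (all_linked s0 x).
by rewrite setDv setU0.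
Qed.

(** If a sixth vertex existed, the layers around [u] would begin with sizes
    1, 3, 1, 1, and so there would be a path [u], [a], [w], [z] going away from
    [u]; observing from [a], two steps reach [u], its three neighbors, [w] and [z]. *)
Lemma card_of_degree3 u : #|nbrs u| = 3 -> #|G| <= 5.
Proof.
move=> deg_u; rewrite leqNgt; apply/negP=> gt5.
have card_O2 : #|observed k [set u] 2| <= 5 := card_observed 2 (optimal1 u).
have /subsetPn[z0 _ z0O] : ~~ ([set: G] \subset observed k [set u] 2).
  apply/negP=> /subset_leq_card; rewrite cardsT => /(leq_trans gt5).
  by rewrite ltnNge card_O2.
have uO : u \in observed k [set u] 2 by apply: mem_observed; rewrite inE.
have [w [z [wO zO wz]]] := crossing_edge (all_linked u z0) uO z0O.
have wO1 : w \notin observed k [set u] 1.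
  by apply: contra zO => /nbrs_observed; apply.
have Nu y : (y \in observed k [set u] 1) = (y == u) || adj u y.
  by rewrite /= /closed_nbrs big_set1 !inE.
have [a ua aw] : exists2 a, adj u a & adj a w.
  move: wO; rewrite -[observed _ _ _]/(propagate k (observed k [set u] 1)) inE (negbTE wO1) inE.
  case/existsP=> a; rewrite Nu => /and3P[/predU1P[->|ua] aw _].
    by move: wO1 aw; rewrite Nu !inE => /norP[_ /negbTE->]; rewrite andbF.
  by exists a; rewrite // !inE in aw *; case/andP: aw.
have zO1 : z \notin observed k [set u] 1.
  by apply: contra zO; apply/subsetP/observed_subS.
have card6 : #|w |: (z |: (u |: nbrs u))| = 6.
  rewrite Nu in wO1; rewrite Nu in zO1.
  rewrite !cardsU1 deg_u !inE adj_irr (negbTE wO1) (negbTE zO1) orbF.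
  by have [eq_wz|] := eqVneq w z; rewrite // -eq_wz wO in zO.
have := card_observed 2 (optimal1 a); rewrite leqNgt => /negP; apply.
rewrite -[5.+1]card6; apply/subset_leq_card/subsetP=> y.
have aO : a \in observed k [set a] 0 by rewrite inE.
have uO1 : u \in observed k [set a] 1 by apply: nbrs_observed aO _; rewrite adj_sym.
have wOa := nbrs_observed aO aw.
case/setU1P=> [->|/setU1P[->|/setU1P[->|]]].
- exact: (subsetP (observed_subS _ _ _)).
- exact: nbrs_observed wOa wz.
- exact: (subsetP (observed_subS _ _ _)).
by rewrite inE; apply: nbrs_observed uO1.
Qed.

(** Four vertices mean propagation time 1, whereas domination alone reaches at
    most three of them. *)
Lemma card_neq4_of_degree2 : (forall x, #|nbrs x| <= 2) -> #|G| <> 4.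
Proof.
move=> deg2 card4; have ppt1 : ppt k G = 1 by lia.
have := congr1 (fun A : {set G} => #|A|) full1; rewrite ppt1 /= /closed_nbrs big_set1.
by rewrite cardsU1 cardsT card4 inE adj_irr; have := deg2 s0; lia.
Qed.

Lemma one_observer :
  [\/ isom G (path_graph 5) \/ isom G (cycle_graph 5),
      isom G (path_graph 6) \/ isom G (cycle_graph 6),
      [\/ isom G (complete_bipartite 1 3), isom G L31, isom G K4_minus_edge
        | isom G (complete_graph 4)]
    | frakG G].
Proof.
have [/existsP[u /eqP deg_u]|/existsPn no3] := boolP [exists u, #|@nbrs G u| == 3].
  have ge4 : 4 <= #|G|.
    by apply: leq_trans (max_card (u |: nbrs u)); rewrite cardsU1 deg_u inE adj_irr.
  have [card4|ne4] := eqVneq #|G| 4; first by constructor 3; apply: four_vertices_degree3 deg_u.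
  constructor 4; split; first exact: all_linked.
    by have := card_of_degree3 deg_u; lia.
  apply/eqP; rewrite eqn_leq -{2}deg_u (leq_bigmax u) andbT.
  by apply/bigmax_leqP=> x _; apply: degree_le3.
have deg2 x : #|nbrs x| <= 2 by rewrite -ltnS ltn_neqAle no3 degree_le3.
have [|p [Up adj_p all_p]] := @covering_path G s0; first by move=> x _.
have size_p : size p = #|G|.
  rewrite -(card_uniqP Up); apply/eq_card=> x; rewrite all_p.
  exact: all_linked.
have le6 : size p <= 6.
  (* The fourth vertex of a path on seven reaches all of them in three steps. *)
  case: p Up adj_p {all_p size_p} => [|a [|b [|c [|d [|e [|f [|g p]]]]]]] //.
  rewrite -[_ :: _](cat_take_drop 7) cat_uniq /= take0 => /andP[U7 _].
  case/and5P=> ab bc cd de /and3P[ef fg _].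
  suff sub : {subset [:: a; b; c; d; e; f; g] <= observed k [set d] 3}.
    by have := @size_observed _ [:: a; b; c; d; e; f; g] _ (optimal1 d) U7 sub.
  have d0 : d \in observed k [set d] 0 by rewrite inE.
  have e1 := nbrs_observed d0 de; have f2 := nbrs_observed e1 ef.
  have c1 : c \in observed k [set d] 1 by apply: nbrs_observed d0 _; rewrite adj_sym.
  have b2 : b \in observed k [set d] 2 by apply: nbrs_observed c1 _; rewrite adj_sym.
  have a3 : a \in observed k [set d] 3 by apply: nbrs_observed b2 _; rewrite adj_sym.
  have g3 := nbrs_observed f2 fg.
  have up t x : x \in observed k [set d] t -> t <= 3 -> x \in observed k [set d] 3.
    by move=> xt /observed_sub/subsetP; apply.
  apply/allP; rewrite [all _ _]/= a3 g3 (up _ _ b2) // (up _ _ c1) // (up _ _ d0) //.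
  by rewrite (up _ _ e1) // (up _ _ f2).
have ne3 : #|G| <> 3.
  move=> card3; have ppt0 : ppt k G = 0 by lia.
  by have := cardsT G; rewrite -full1 ppt0 cards1 card3.
have ne4 := card_neq4_of_degree2 deg2.
have cases : #|G| = 5 \/ #|G| = 6 by lia.
case: cases => cardG; [constructor 1 | constructor 2].
  exact: (isom_path_or_cycle Up adj_p (in1W deg2) (etrans size_p cardG)).
exact: (isom_path_or_cycle Up adj_p (in1W deg2) (etrans size_p cardG)).
Qed.

End OneObserver.

(** * Two components *)

Section TwoObservers.

(** The observers with [x], [y] and a further neighbor [z] of [r] would be five
    vertices at distance at most 1. *)
Lemma two_observers_leaf r s x y z :
  optimal [set r; s] -> r != s -> adj r x -> adj s y -> adj r z -> z = x.
Proof.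
move=> opt ne_rs rx sy rz; apply/eqP/negPn/negP=> ne_zx.
have rs := optimal_unlinked opt (set21 r s) (set22 r s) ne_rs.
have ry : ~~ linked r y.
  by apply: contra rs => /linked_nbr; apply; rewrite adj_sym.
have U : uniq [:: r; x; z; s; y].
  have neq_s v (rv : linked r v) := unlinked_neq rv rs.
  have neq_y v (rv : linked r v) := unlinked_neq rv ry.
  rewrite /= !inE !negb_or (adj_neq rx) (adj_neq rz) (adj_neq sy) (eq_sym x) ne_zx.
  by rewrite !neq_s ?neq_y ?connect0 ?connect1.
suff sub : {subset [:: r; x; z; s; y] <= observed k [set r; s] 1}.
  by have := size_observed opt U sub.
have r0 : r \in observed k [set r; s] 0 by rewrite set21.
have s0 : s \in observed k [set r; s] 0 by rewrite set22.
have r1 : r \in observed k [set r; s] 1 by apply: mem_observed.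
have s1 : s \in observed k [set r; s] 1 by apply: mem_observed.
have := (nbrs_observed r0 rx, nbrs_observed r0 rz, nbrs_observed s0 sy).
by case=> -[x1 z1] y1; apply/allP; rewrite [all _ _]/= r1 s1 x1 y1 z1.
Qed.

Lemma optimal_move2 r s x :
  optimal [set r; s] -> r != s -> linked r x -> optimal [set x; s].
Proof.
move=> opt ne_rs rx; have := optimal_move opt (set21 r s) rx.
by rewrite setU1K ?inE.
Qed.

Lemma isom_K2_K2 r s x y :
  optimal [set r; s] -> r != s -> adj r x -> adj s y ->
  isom G (union_graph (complete_graph 2) (complete_graph 2)).
Proof.
move=> opt ne_rs rx sy; have opt' : optimal [set s; r] by rewrite setUC.
have rs := optimal_unlinked opt (set21 r s) (set22 r s) ne_rs.
have leaf_r := two_observers_leaf opt ne_rs rx sy.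
have leaf_s : forall z, adj s z -> z = y.
  by move=> z; apply: two_observers_leaf opt' _ sy rx; rewrite eq_sym.
have ne_xs : x != s by apply: unlinked_neq rs; apply: connect1.
have opt_x := optimal_move2 opt ne_rs (connect1 rx).
have leaf_x : forall z, adj x z -> z = r.
  by move=> z; apply: two_observers_leaf opt_x ne_xs _ sy; rewrite adj_sym.
have ne_yr : y != r.
  by apply: unlinked_neq (connect1 sy) _; rewrite linked_sym.
have opt_y : optimal [set y; r].
  by apply: optimal_move2 opt' _ (connect1 sy); rewrite eq_sym.
have leaf_y : forall z, adj y z -> z = s.
  by move=> z; apply: two_observers_leaf opt_y ne_yr _ rx; rewrite adj_sym.
have ne_xy : x != y.
  by apply: contraNneq ne_rs => eq_xy; rewrite (leaf_x s) // eq_xy adj_sym.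
have U : uniq [:: r; x; s; y].
  by rewrite /= !inE !negb_or ne_rs ne_xs ne_xy (adj_neq rx) (adj_neq sy) eq_sym ne_yr.
have cover : [set z in [:: r; x; s; y]] = [set: G].
  apply: (closed_covers opt).
    by apply/subsetP=> z; rewrite !inE => /orP[] ->; rewrite ?orbT.
  move=> w z; rewrite !inE => /or4P[] /eqP->.
  - by move/leaf_r->; rewrite eqxx orbT.
  - by move/leaf_x->; rewrite eqxx.
  - by move/leaf_s->; rewrite eqxx !orbT.
  by move/leaf_y->; rewrite eqxx !orbT.
have card4 : 4 = #|G| by rewrite -cardsT -cover cardsE (card_uniqP U).
apply: (@isom_of_lists G (union_graph (complete_graph 2) (complete_graph 2)) r
  (inl ord0) [:: r; x; s; y] [:: inl ord0; inl ord_max; inr ord0; inr ord_max]) => //=.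
  by rewrite card_sum !card_ord.
have no v w z : (forall t, adj v t -> t = z) -> w != z -> adj v w = false.
  by move=> leaf; apply: contraNF => /leaf->.
by rewrite rx sy !(no r _ x) // 1?eq_sym // !(no x _ r) // 1?eq_sym.
Qed.

Section IsolatedObserver.

Variables r s : G.
Hypotheses (opt : optimal [set r; s]) (ne_rs : r != s).
Hypotheses (full : observed k [set r; s] (ppt k G) = [set: G]).
Hypothesis isolated : forall z, ~~ adj s z.

Lemma isolated_unlinked x : x != s -> linked r x.
Proof.
move=> ne_xs; have [t] := optimal_linked x opt.
rewrite !inE => /orP[/eqP->//|/eqP-> sx].
have := crossing_edge sx (set11 s); rewrite inE ne_xs.
by case=> // w [z [/set1P-> _]]; rewrite (negbTE (isolated z)).
Qed.

Lemma isolated_observer :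
  (isom G (union_graph (complete_graph 1) (path_graph 3)) \/
   isom G (union_graph (complete_graph 1) (cycle_graph 3))) \/
  (isom G (union_graph (complete_graph 1) (path_graph 4)) \/
   isom G (union_graph (complete_graph 1) (cycle_graph 4))).
Proof.
have rs := optimal_unlinked opt (set21 r s) (set22 r s) ne_rs.
have deg2 x : linked r x -> #|nbrs x| <= 2.
  move=> rx; have optx := optimal_move2 opt ne_rs rx.
  have := card_optimal_nbrs optx (set21 x s).
  rewrite -setUA !cardsU1 !inE adj_irr (negbTE (unlinked_neq rx rs)).
  by rewrite adj_sym (negbTE (isolated x)).
have [p [Up adj_p all_p]] := covering_path deg2.
have sp : s \notin p by rewrite all_p.
have size_p : (size p).+1 = #|G|.
  have /card_uniqP/esym card_p : uniq (s :: p) by rewrite /= sp.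
  apply: (etrans card_p); apply/eq_card=> x.
  rewrite inE all_p; have [//|/isolated_unlinked rx] := eqVneq x s.
  exact: rx.
have le4 : size p <= 4.
  (* With [s], the five vertices around the third one are six at distance 2. *)
  case: p Up adj_p sp {all_p size_p} (all_p) => [|a [|b [|c [|d [|e p]]]]] //.
  rewrite -[_ :: _](cat_take_drop 5) cat_uniq /= take0 => /andP[U5 _].
  case/and5P=> ab bc cd de _ sp all_p.
  have rc : linked r c by rewrite -[linked r c]all_p !inE eqxx !orbT.
  have optc := optimal_move2 opt ne_rs rc.
  suff sub : {subset [:: s; a; b; c; d; e] <= observed k [set c; s] 2}.
    have U : uniq [:: s; a; b; c; d; e].
      rewrite cons_uniq; apply/andP; split; last exact: U5.
      by apply: contra sp; rewrite !inE !orbA => ->.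
    by have := size_observed optc U sub.
  have c0 : c \in observed k [set c; s] 0 by rewrite set21.
  have d1 := nbrs_observed c0 cd; have e2 := nbrs_observed d1 de.
  have b1 : b \in observed k [set c; s] 1 by apply: nbrs_observed c0 _; rewrite adj_sym.
  have a2 : a \in observed k [set c; s] 2 by apply: nbrs_observed b1 _; rewrite adj_sym.
  have b2 := subsetP (observed_subS k [set c; s] 1) _ b1.
  have d2 := subsetP (observed_subS k [set c; s] 1) _ d1.
  have c2 : c \in observed k [set c; s] 2 by rewrite mem_observed ?set21.
  have s2 : s \in observed k [set c; s] 2 by rewrite mem_observed ?set22.
  by apply/allP; rewrite [all _ _]/= a2 b2 c2 d2 e2 s2.
have ne2 : size p <> 2.
  move=> size2; have ppt0 : ppt k G = 0 by lia.
  have card3 : #|G| = 3 := etrans (esym size_p) (congr1 succn size2).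
  by have := cardsT G; rewrite -full ppt0 cards2 ne_rs card3.
have deg2p x : x \in p -> #|nbrs x| <= 2 by rewrite all_p; apply: deg2.
have cases : size p = 3 \/ size p = 4 by lia.
by case: cases => size_m; [left | right];
  apply: (isom_K1_path_or_cycle Up adj_p deg2p size_m _ sp) => //;
  exact: etrans (esym size_p) (congr1 succn size_m).
Qed.

End IsolatedObserver.

Lemma two_observers r s :
  optimal [set r; s] -> r != s -> observed k [set r; s] (ppt k G) = [set: G] ->
  [\/ isom G (union_graph (complete_graph 2) (complete_graph 2)),
      isom G (union_graph (complete_graph 1) (path_graph 3)) \/
      isom G (union_graph (complete_graph 1) (cycle_graph 3))
    | isom G (union_graph (complete_graph 1) (path_graph 4)) \/
      isom G (union_graph (complete_graph 1) (cycle_graph 4))].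
Proof.
move=> opt ne_rs full.
have [iso_s|[y sy]] := set_0Vmem (nbrs s).
  have iso z : ~~ adj s z by have := in_set0 z; rewrite -iso_s inE => ->.
  by case: (isolated_observer opt ne_rs full iso); [constructor 2 | constructor 3].
have [iso_r|[x rx]] := set_0Vmem (nbrs r).
  have iso z : ~~ adj r z by have := in_set0 z; rewrite -iso_r inE => ->.
  rewrite setUC eq_sym in opt ne_rs full.
  by case: (isolated_observer opt ne_rs full iso); [constructor 2 | constructor 3].
rewrite !inE in rx sy.
by constructor 1; apply: isom_K2_K2 opt ne_rs rx sy.
Qed.

End TwoObservers.

(** * Three components *)

Section ThreeObservers.

Lemma containing3 S x : optimal S -> #|S| = 3 ->
  exists r s, optimal [set x; r; s] /\ uniq [:: x; r; s].
Proof.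
move=> optS card3; have [T [optT xT]] := optimal_containing x optS.
rewrite card3 (cardsD1 x T) xT add1n => /eqP; rewrite eqSS => /cards2P[r [s [ne_rs eq_T]]].
have mem_T z : z \in T = (z == x) || (z == r) || (z == s).
  by have := setD1K xT; rewrite eq_T => <-; rewrite !inE orbA.
have eqT : [set x; r; s] = T by apply/setP=> z; rewrite mem_T !inE.
exists r, s; rewrite eqT; split=> //=.
by have := setD11 x T; rewrite eq_T !inE ne_rs => ->.
Qed.

(** The endpoints [y] and [z] lie outside [S], so they coincide, since otherwise
    five vertices are at distance at most 1; and then [v] and [x] are linked
    through this common neighbor. *)
Lemma three_observers_edge S x y v z :
  optimal S -> #|S| = 3 -> x \in S -> adj x y -> v \in S -> adj v z ->
  v = x /\ z = y.
Proof.
move=> optS card3 xS xy vS vz.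
have notS t w : t \in S -> adj t w -> w \notin S.
  move=> tS tw; apply: contraTN (connect1 tw) => wS.
  exact: optimal_unlinked optS tS wS (adj_neq tw).
have eq_zy : z = y.
  apply/eqP/negPn/negP=> ne_zy; have := card_observed 1 optS.
  rewrite leqNgt => /negP; apply; apply: leq_trans (_ : #|z |: (y |: S)| <= _).
    by rewrite !cardsU1 !inE negb_or ne_zy (notS v) // (notS x) // card3.
  apply/subset_leq_card; rewrite !subUset !sub1set (observed_sub _ _ (leq0n 1)) andbT.
  by rewrite !(nbrs_observed _ vz, nbrs_observed _ xy).
split=> //; apply/eqP/negPn/negP=> ne_vx.
case/negP: (optimal_unlinked optS vS xS ne_vx).
by apply: linked_nbr (connect1 vz) _; rewrite eq_zy adj_sym.
Qed.

Lemma three_observers S :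
  optimal S -> #|S| = 3 ->
  isom G (compl_graph (complete_graph 3)) \/
  isom G (union_graph (compl_graph (complete_graph 2)) (complete_graph 2)).
Proof.
move=> optS card3.
have [/existsP[x /existsP[y xy]]|no_edge] := boolP [exists x, exists y, @adj G x y].
  right; have [r [s [opt U]]] := containing3 x optS card3.
  have card_x : #|[set x; r; s]| = 3.
    by rewrite -setUA !cardsU1 cards1; move: U; rewrite /= !inE => /and3P[-> ->].
  have xS : x \in [set x; r; s] by rewrite !inE eqxx.
  have edge v z : v \in [set x; r; s] -> adj v z -> v = x /\ z = y.
    exact: three_observers_edge opt card_x xS xy.
  have ne_rx : r != x by move: U; rewrite /= !inE negb_or eq_sym => /andP[/andP[]].
  have ne_sx : s != x by move: U; rewrite /= !inE negb_or (eq_sym s) => /andP[/andP[]].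
  have iso_r z : adj r z = false.
    by apply/negP=> /edge[|eq_rx _]; [rewrite !inE eqxx orbT | rewrite eq_rx eqxx in ne_rx].
  have iso_s z : adj s z = false.
    by apply/negP=> /edge[|eq_sx _]; [rewrite !inE eqxx orbT | rewrite eq_sx eqxx in ne_sx].
  have yS : y \notin [set x; r; s].
    rewrite !inE !negb_or eq_sym (adj_neq xy) /=.
    by apply/andP; split; apply: contraTneq xy => ->; rewrite adj_sym ?iso_r ?iso_s.
  have leaf_y z : adj y z -> z = x.
    move=> yz; have opty := optimal_move opt xS (connect1 xy).
    have [//|card_y] := min_power_dominating_le opt (proj1 (andP opty)).
      by rewrite cardsU1 (cardsD1 x [set x; r; s]) xS leq_add2r leq_b1.
    rewrite card_x => cardy.
    have yx : adj y x by rewrite adj_sym.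
    by case: (three_observers_edge opty cardy (setU11 _ _) yx (setU11 _ _) yz).
  have cover : [set z in [:: r; s; x; y]] = [set: G].
    apply: (closed_covers opt).
      by apply/subsetP=> z; rewrite !inE => /orP[/orP[]|] ->; rewrite ?orbT.
    move=> w z; rewrite !inE => /or4P[] /eqP->.
    - by rewrite iso_r.
    - by rewrite iso_s.
    - by move=> xz; have [_ ->] := edge x z xS xz; rewrite eqxx !orbT.
    by move/leaf_y->; rewrite eqxx !orbT.
  have U4 : uniq [:: r; s; x; y].
    move: U yS; rewrite /= !inE !negb_or.
    move=> /and3P[_ ne_rs _] /andP[/andP[yx yr] ys].
    by rewrite ne_rs ne_rx ne_sx !(eq_sym _ y) yx yr ys.
  have card4 : 4 = #|G| by rewrite -cardsT -cover cardsE (card_uniqP U4).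
  apply: (@isom_of_lists G (union_graph (compl_graph (complete_graph 2)) (complete_graph 2)) r
    (inl ord0) [:: r; s; x; y] [:: inl ord0; inl ord_max; inr ord0; inr ord_max]) => //=.
    by rewrite card_sum !card_ord.
  by rewrite !iso_r !iso_s xy.
left; have iso x z : adj x z = false.
  by apply/negP=> xz; case/existsP: no_edge; exists x; apply/existsP; exists z.
have eqS : S = [set: G] by apply: (closed_covers optS) => // w z _; rewrite iso.
have [x [y [z [U _]]]] := enum_set3 card3.
rewrite eqS cardsT in card3.
apply: (@isom_of_lists G (compl_graph (complete_graph 3)) x ord0 [:: x; y; z]
  [:: ord0; @Ordinal 3 1 isT; ord_max]) => //=.
  by rewrite card_ord.
by rewrite !iso.
Qed.

End ThreeObservers.

End Extremal.

(** * The classification *)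

Theorem theorem33 (k n : nat) (G : sgraph)
    (hk : 2 <= k) (hn : #|G| = n) (hG : ppt k G + 3 = n) :
  isom G (path_graph 5) \/
  isom G (path_graph 6) \/
  isom G (cycle_graph 5) \/
  isom G (cycle_graph 6) \/
  isom G (complete_bipartite 1 3) \/
  isom G L31 \/
  isom G K4_minus_edge \/
  isom G (complete_graph 4) \/
  isom G (union_graph (complete_graph 1) (path_graph 3)) \/
  isom G (union_graph (complete_graph 1) (path_graph 4)) \/
  isom G (union_graph (complete_graph 1) (cycle_graph 3)) \/
  isom G (union_graph (complete_graph 1) (cycle_graph 4)) \/
  isom G (union_graph (complete_graph 2) (complete_graph 2)) \/
  isom G (compl_graph (complete_graph 3)) \/
  isom G (union_graph (compl_graph (complete_graph 2)) (complete_graph 2)) \/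
  frakG G.
Proof.
have pptG : ppt k G + 3 = #|G| by rewrite hG hn.
have [S optS full] := ppt_witness k G.
have le3 : #|S| <= 3 := card_observed hk pptG 0 optS.
have [card0|card_gt0] := posnP #|S|.
  have [s] : exists s, s \in [set: G] by apply/set0Pn; rewrite -card_gt0 cardsT -pptG addnS.
  by have [t] := optimal_linked s optS; rewrite (cards0_eq card0) inE.
have : [|| #|S| == 1, #|S| == 2 | #|S| == 3] by lia.
case/or3P=> [/cards1P[s eqS]|/cards2P[r [s [ne_rs eqS]]]|/eqP card3].
- rewrite eqS in optS full; have := one_observer hk pptG optS full; case=> [||[]|]; tauto.
- rewrite eqS in optS full; have := two_observers hk pptG optS ne_rs full; case; tauto.
by have := three_observers hk pptG optS card3; tauto.
Qed.
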